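(* Fix a Polish sample space $\Omega$ and let $F,R$ be partially ordered topological spaces that are Souslin spaces with Borel order relations. The evaluation map $$\mathrm{ev}:\mathrm{DP}_\Omega(F,R)\times F^{\mathbb N}\times R^{\mathbb N}\to\mathrm{Bool},\quad (\mathrm{dp},(x_{F,i})_{i\in\mathbb N},(x_{R,i})_{i\in\mathbb N})\mapsto\big(\forall i\in\mathbb N,\ (x_{F,i},x_{R,i})\in\mathrm{dp}\big)$$ is quasi-measurable.
   Context: A Souslin space is a Hausdorff space that is a continuous image of a Polish space; analytic sets are continuous images of Polish spaces; a subset of a Polish space is universally measurable if it is measurable for the completion of the Borel $\sigma$-algebra with respect to every Borel probability measure. Quasi-universal spaces: a set $A$ with a set of maps $\Omega\to A$ (random variables) containing constants and closed under precomposition with Borel measurable maps $\Omega\to\Omega$; a map $f:A\to B$ is quasi-measurable if $f\circ\alpha$ is a random variable of $B$ for every random variable $\alpha$ of $A$; random variables of a product are pairs (tuples) of random variables. Conventions: the random variables of $F$ (resp. $R$) are the Borel measurable maps $\Omega\to F$; those of $\mathbb N$ are the measurable maps into $\mathbb N$ (discrete); $\mathrm{Bool}=\{\bot,\top\}$ has as random variables the maps $\Omega\to\mathrm{Bool}$ whose preimage of $\top$ is universally measurable. $F^{\mathbb N}$ is the set of sequences in $F$ (quasi-measurable maps $\mathbb N\to F$), whose random variables are the maps $\beta:\Omega\to F^{\mathbb N}$ such that $\omega\mapsto\beta(\varphi(\omega))(\gamma(\omega))$ is a random variable of $F$ for every random variable $\gamma$ of $\mathbb N$ and every measurable $\varphi:\Omega\to\Omega$;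 likewise for $R^{\mathbb N}$. $\mathrm{DP}_\Omega(F,R)$ is the set of upper sets of $F^{\mathrm{op}}\times R$ ($F$ with reversed order, componentwise order) of the form $\uparrow A$ with $A$ analytic, whose random variables are the maps $\alpha:\Omega\to\mathrm{DP}_\Omega(F,R)$ with analytic feasible set $\{(\omega,x_F,x_R):(x_F,x_R)\in\alpha(\omega)\}\subseteq\Omega\times F\times R$. *)

(* Defs.v *)
From HB Require Import structures.
From mathcomp Require Import all_boot all_order all_algebra.
From mathcomp Require Import all_classical all_reals all_analysis.
From mathcomp Require Import Rstruct Rstruct_topology.
Set Implicit Arguments. Unset Strict Implicit. Unset Printing Implicit Defensive.
Import Order.TTheory GRing.Theory Num.Theory.
Local Open Scope classical_set_scope.
Local Open Scope ring_scope.

Notation real := Rdefinitions.R.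

Definition polish (T : topologicalType) : Prop :=
  (exists D : set T, countable D /\ dense D) /\
  exists d : T -> T -> real,
    [/\ (forall x y, 0 <= d x y) /\ (forall x y, d x y = 0 <-> x = y),
        (forall x y, d x y = d y x),
        (forall x y z, d x z <= d x y + d y z),
        (forall A : set T, open A <->
           forall x, A x -> exists2 e : real, 0 < e & [set y | d x y < e] `<=` A) &
        (forall u : nat -> T,
           (forall e : real, 0 < e -> exists N, forall m n, (N <= m)%N -> (N <= n)%N -> d (u m) (u n) < e) ->
           exists l : T, u @ \oo --> l)].

Definition analytic (X : topologicalType) (A : set X) : Prop :=
  A = set0 \/ exists (P : topologicalType) (f : P -> X), [/\ polish P, continuous f & range f = A].

Definition souslin (X : topologicalType) : Prop := hausdorff_space X /\ analytic (@setT X).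

Definition borel (X : topologicalType) (A : set X) : Prop := <<s @open X >> A.

Definition partial_order (X : Type) (le : X -> X -> Prop) : Prop :=
  [/\ forall x, le x x, forall x y, le x y -> le y x -> x = y &
      forall x y z, le x y -> le y z -> le x z].

Definition borel_order (X : topologicalType) (le : X -> X -> Prop) : Prop :=
  borel [set p : X * X | le p.1 p.2].

Section QUS.
Variable Omega : ptopologicalType.

Definition OmegaB := g_sigma_algebraType (@open Omega).

Definition universally_measurable (A : set Omega) : Prop :=
  forall P : probability OmegaB real,
    exists (B N : set OmegaB),
      [/\ measurable B, negligible P N & A = B `|` N].

Definition borel_measurable (X Y : topologicalType) (f : X -> Y) : Prop :=
  forall B : set Y, borel B -> borel (f @^-1` B).

(* random variables of the basic quasi-universal spaces *)
Definition rv_top (X : topologicalType) (f : Omega -> X) : Prop :=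
  borel_measurable f.
Definition rv_nat (f : Omega -> nat) : Prop :=
  forall B : set nat, borel (f @^-1` B).
Definition rv_bool (b : Omega -> bool) : Prop :=
  universally_measurable [set w | b w = true].

Definition qm_seq (X : topologicalType) (s : nat -> X) : Prop :=
  forall g : Omega -> nat, rv_nat g -> rv_top (s \o g).
Definition seqQ (X : topologicalType) := {s : nat -> X | qm_seq s}.
Definition rv_seq (X : topologicalType) (b : Omega -> seqQ X) : Prop :=
  forall (phi : Omega -> Omega) (g : Omega -> nat),
    borel_measurable phi -> rv_nat g ->
    rv_top (fun w => proj1_sig (b (phi w)) (g w)).

Section DP.
Variables (F R : topologicalType) (leF : F -> F -> Prop) (leR : R -> R -> Prop).

(* upward closure in F^op x R *)
Definition upclosure (A : set (F * R)) : set (F * R) :=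
  [set p | exists2 a, A a & leF p.1 a.1 /\ leR a.2 p.2].

Definition DP := {U : set (F * R) | exists A, analytic A /\ U = upclosure A}.

Definition rv_DP (a : Omega -> DP) : Prop :=
  analytic [set t : Omega * (F * R) | proj1_sig (a t.1) t.2].

Definition ev (x : DP * seqQ F * seqQ R) : bool :=
  `[< forall i : nat, proj1_sig x.1.1 (proj1_sig x.1.2 i, proj1_sig x.2 i) >].

Definition rv_DP_seq_seq (d : Omega -> DP * seqQ F * seqQ R) : Prop :=
  [/\ rv_DP (fun w => (d w).1.1), rv_seq (fun w => (d w).1.2) & rv_seq (fun w => (d w).2)].

Definition ev_quasi_measurable : Prop :=
  forall d, rv_DP_seq_seq d -> rv_bool (ev \o d).
End DP.
End QUS.

(* Main.v *)
(* A random variable of DP(F,R) has as feasible set the image of a Polish space P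
   under a continuous map h = (a, b, c).  In a Souslin space, inequality x <> y is
   covered by countably many open boxes U_i x V_i, because two points separated
   by open sets are already separated by images of cells of a countable sieve.
   Hence, for Borel maps f and g, the points w with (w, f w, g w) feasible form
   the projection to Omega of the complement of a countable union of boxes
   (open in P) x (Borel in Omega), and such a projection is measurable for the
   completion of every probability. *)
Require Import Defs.
From HB Require Import structures.
From mathcomp Require Import all_boot all_order all_algebra.
From mathcomp Require Import all_classical all_reals all_analysis.
From mathcomp Require Import Rstruct Rstruct_topology lra.
Import Order.TTheory GRing.Theory Num.Theory.
Local Open Scope classical_set_scope.
Local Open Scope ring_scope.

(** * Countable sieves of small cells in Polish spaces *)

Lemma natSinv_small (e : real) : 0 < e -> exists n, n.+1%:R^-1 < e.
Proof.
move=> e0; have [N _ HN] := near_infty_natSinv_lt (PosNum e0).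
by exists N; apply: HN => /=.
Qed.

Lemma metric_ball_open (X : topologicalType) (d : X -> X -> real) :
  (forall x y z, d x z <= d x y + d y z) ->
  (forall A : set X, open A <->
    forall x, A x -> exists2 e : real, 0 < e & [set y | d x y < e] `<=` A) ->
  forall x e, open [set y | d x y < e].
Proof.
move=> dT dO x e; apply/dO => y /= dxy.
exists (e - d x y); first by rewrite subr_gt0.
by move=> z /= dyz; have := dT x y z; lra.
Qed.

(** Cells of level j are balls of radius 1/(j+1) centred in a countable dense set. The last clause
    is completeness without a metric: the points [p k] form a Cauchy sequence, and the cells of the
    branch shrink to its limit, which need not belong to them. *)
Lemma polish_sieve (P : topologicalType) : polish P ->
  exists cell : nat -> nat -> set P,
  [/\ forall j p, exists n, cell j n p,
      forall U p, open U -> U p -> exists j, forall n, cell j n p -> cell j n `<=` U &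
      forall (s : nat -> nat) (p : nat -> P),
        (forall j k, (j < k)%N -> cell j (s j) (p k)) ->
        exists l, forall U, open U -> U l -> exists j, cell j (s j) `<=` U].
Proof.
move=> [[D [cD dD]] [d [[d_ge0 d_eq0] dC dT dO d_complete]]].
have /countable_injP[code code_inj] := cD.
pose rad j : real := j.+1%:R^-1.
(* As [code] is injective on [D], a cell is a single ball, or empty when n codes no point. *)
pose cell j n := [set p | exists x, [/\ D x, code x = n & d x p < rad j]].
have ball_open := @metric_ball_open P d dT dO.
have cell_small j n p q : cell j n p -> cell j n q -> d p q < 2 * rad j.
  move=> [x [Dx nx dx]] [y [Dy ny dy]].
  have exy : x = y by apply: code_inj; rewrite ?inE ?nx.
  by subst y; move: dx dy; have := dT p x q; rewrite (dC p x); lra.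
exists cell; split.
- move=> j p; have [|x [/= xp Dx]] := dD [set y | d p y < rad j] _ (ball_open _ _).
    by exists p => /=; have [_ ->] := d_eq0 p p; rewrite // invr_gt0 ltr0Sn.
  by exists (code x), x; split=> //; rewrite dC.
- move=> U p /dO oU /oU[e e0 peU].
  have [j je] : exists j, rad j < e / 2 by apply: natSinv_small; lra.
  exists j => n pn q qn; apply: peU => /=.
  by have := cell_small _ _ _ _ pn qn; lra.
- move=> s p sp.
  have [|l pl] := d_complete p.
    move=> e e0; have [N Ne] : exists N, rad N < e / 2 by apply: natSinv_small; lra.
    exists N.+1 => m n Nm Nn.
    by have := cell_small _ _ _ _ (sp _ _ Nm) (sp _ _ Nn); lra.
  exists l => U /dO oU /oU[e e0 leU].
  have [N Ne] : exists N, rad N < e / 4 by apply: natSinv_small; lra.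
  have [M _ HM] : \forall n \near \oo, d l (p n) < e / 4.
    apply: (pl [set y | d l y < e / 4]); apply: open_nbhs_nbhs; split.
      exact: ball_open.
    by rewrite /=; have [_ ->] := d_eq0 l l => //; lra.
  (* The index [maxn M N.+1] is late enough to be close to l and to put the point in the cell of
     level N; then d l q < e/4 + 2 * rad N < e. *)
  exists N => q qN; apply: leU => /=.
  have lp : d l (p (maxn M N.+1)) < e / 4 by apply: HM; exact: leq_maxl.
  have := cell_small _ _ _ _ (sp N _ (leq_maxr M N.+1)) qN.
  by have := dT l (p (maxn M N.+1)) q; lra.
Qed.

Lemma polish_souslin (P : topologicalType) : polish P -> souslin P.
Proof.
move=> polP; split; last first.
  right; exists P, id; split => //; first by move=> ?; exact: cvg_id.
  by rewrite image_id.
have [_ [d [[d_ge0 d_eq0] dC dT dO _]]] := polP.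
have ball_open := @metric_ball_open P d dT dO.
have ball_center x e : 0 < e -> d x x < e by have [_ ->] := d_eq0 x x.
rewrite open_hausdorff => x y xy.
have dxy : 0 < d x y / 2.
  rewrite divr_gt0// lt_neqAle d_ge0 andbT eq_sym.
  by apply: contra_neq xy => /d_eq0.
exists ([set z | d x z < d x y / 2], [set z | d y z < d x y / 2]) => /=.
  by rewrite !inE; split; exact: ball_center.
split; [exact: ball_open..|].
apply/eqP/seteqP; split=> // z /= [xz yz].
by have := dT x z y; rewrite (dC z y); lra.
Qed.

(** * Countable separation of points in Souslin spaces *)

Lemma souslin_separation (X : topologicalType) : souslin X ->
  exists (I : countType) (U V : I -> set X),
  [/\ forall i, open (U i), forall i, open (V i) &
      forall x y, x = y <-> forall i, ~ (U i x /\ V i y)].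
Proof.
move=> [hX [X0|[Q [q [polQ q_cont q_onto]]]]].
  have noX (x : X) : False by have : [set: X] x by []; rewrite X0.
  by exists void, (fun=> set0), (fun=> set0); split=> // x; case: (noX x).
have [cell [cell_cover cell_base _]] := polish_sieve Q polQ.
pose separates (i : nat * nat * (nat * nat)) (UV : set X * set X) :=
  q @` cell i.1.1 i.1.2 `<=` UV.1 /\ q @` cell i.2.1 i.2.2 `<=` UV.2.
pose disjoint_opens (UV : set X * set X) :=
  [/\ open UV.1, open UV.2 & UV.1 `&` UV.2 = set0].
(* For each pair of cells, choose disjoint open sets separating their images if there are any, and
   two empty sets otherwise. *)
have /choice[UV UVP] i : exists UV, disjoint_opens UV /\
    ((exists2 UV, disjoint_opens UV & separates i UV) -> separates i UV).
  have [[UV oUV sUV]|no] := pselect (exists2 UV, disjoint_opens UV & separates i UV).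
    by exists UV.
  by exists (set0, set0); split=> //; split; rewrite ?set0I//; exact: open0.
have UVo i := (UVP i).1.
exists (nat * nat * (nat * nat))%type, (fun i => (UV i).1), (fun i => (UV i).2).
split=> [i|i|x y]; [by case: (UVo i)..|].
split=> [<- i [Ux Vx]|sep].
  by have [_ _ UV0] := UVo i; have : ((UV i).1 `&` (UV i).2) x by []; rewrite UV0.
apply: contrapT => /eqP xy; move: hX; rewrite open_hausdorff => /(_ x y xy).
move=> [[A B] /= []]; rewrite !inE => Ax By [oA oB AB0].
have [a _ qax] : range q x by rewrite q_onto.
have [b _ qby] : range q y by rewrite q_onto.
have /continuousP q_pre := q_cont.
have [j ja] := cell_base (q @^-1` A) a (q_pre A oA) ltac:(by rewrite /= qax).
have [k kb] := cell_base (q @^-1` B) b (q_pre B oB) ltac:(by rewrite /= qby).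
have [m ma] := cell_cover j a.
have [n nb] := cell_cover k b.
have [|/= sU sV] := (UVP (j, m, (k, n))).2.
  exists (A, B); first by split=> //; apply/eqP.
  split=> /= _ [z zc <-]; first exact: (ja m ma).
  exact: (kb n nb).
apply: (sep (j, m, (k, n))); split; first by apply: sU; exists a.
by apply: sV; exists b.
Qed.

(** * Measurable hulls and measurability of projections *)

Section measurable_projection.
Context {d : measure_display} {T : measurableType d} {R : realType}.
Variable mu : probability T R.

(** Intersect measurable supersets of E whose measures tend to the infimum S. For any other
    measurable superset H', [H] meets H' in a superset of E, so this intersection already carries
    the full measure of [H]. *)
Lemma measurable_hull (E : set T) : exists H,
  [/\ measurable H, E `<=` H &
      forall H', measurable H' -> E `<=` H' -> mu (H `\` H') = 0%E].
Proof.
pose S := [set x | exists A, [/\ measurable A, E `<=` A & x = mu A]].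
have inf_le A : measurable A -> E `<=` A -> (ereal_inf S <= mu A)%E.
  by move=> mA EA; apply: ereal_inf_lbound; exists A.
have inf_fin : ereal_inf S \is a fin_num.
  rewrite ge0_fin_numE.
    by rewrite (le_lt_trans (inf_le setT measurableT _))// probability_setT ltry.
  by apply: le_ereal_inf_tmp => _ [A [_ _ ->]].
have /choice[A AP] (n : nat) : exists A, [/\ measurable A, E `<=` A &
    (mu A < ereal_inf S + (n.+1%:R^-1)%:E)%E].
  have [||_ [A [mA EA ->]] muA] := @lb_ereal_inf_adherent R S n.+1%:R^-1.
  - by rewrite invr_gt0 ltr0Sn.
  - by [].
  - by exists A.
have mA : measurable (\bigcap_n A n).
  by apply: bigcapT_measurable => n; case: (AP n).
exists (\bigcap_n A n); split=> //.
  by move=> x Ex n _; case: (AP n) => _ + _; exact.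
move=> H' mH' EH'.
apply/eqP; rewrite eq_le measure_ge0 andbT.
apply/lee_addgt0Pr => e e0; rewrite add0e.
have [N _ /(_ N (leqnn N)) /= Ne] := near_infty_natSinv_lt (PosNum e0).
rewrite measureD//; last by rewrite (le_lt_trans (probability_le1 _ _)) ?ltry.
rewrite leeBlDr; last by rewrite fin_num_measure//; exact: measurableI.
have [mAN EAN muAN] := AP N.
apply: (@le_trans _ _ (mu (A N))).
  by apply: le_measure; rewrite ?inE// => x /(_ N I).
apply: (le_trans (ltW muAN)); rewrite addeC leeD//; first by rewrite lee_fin ltW.
apply: inf_le; first exact: measurableI.
move=> x Ex; split; last exact: EH'.
by move=> n _; case: (AP n) => _ + _; exact.
Qed.

(* Intersecting a hull with the complements of countably many sets disjoint
   from E keeps it a hull. *)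
Lemma measurable_hull_disjoint (I : countType) (W : I -> set T) (E : set T) :
  (forall i, measurable (W i)) -> exists H,
  [/\ measurable H, E `<=` H,
      forall H', measurable H' -> E `<=` H' -> mu (H `\` H') = 0%E,
      forall i, E `&` W i = set0 -> H `&` W i = set0 &
      E = set0 -> H = set0].
Proof.
move=> mW; have [->|E0] := eqVneq E set0.
  by exists set0; split=> // H' _ _; rewrite set0D measure0.
have [H0 [mH0 EH0 H0min]] := measurable_hull E.
pose J := [set i | E `&` W i = set0].
pose V := \bigcup_i (if i \in J then W i else set0).
have mV : measurable V.
  apply: countable_bigcupT_measurable; first exact: countableP.
  by move=> i; case: ifP.
exists (H0 `\` V); split.
- exact: measurableD.
- move=> x Ex; split; first exact: EH0.
  move=> [i _]; case: ifP => // /set_mem Ji Wx.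
  by have : (E `&` W i) x by []; rewrite Ji.
- move=> H' mH' EH'.
  have := H0min H' mH' EH'; apply: subset_measure0.
  + by apply: measurableD => //; exact: measurableD.
  + exact: measurableD.
  + by move=> x [[]].
- move=> i Ei; apply/seteqP; split=> // x [[_ nVx] Wx]; case: nVx.
  by exists i => //; rewrite ifT// inE.
- by move=> E_0; rewrite E_0 eqxx in E0.
Qed.

Lemma negligible_bigcup_countable (I : countType) (N : I -> set T) :
  (forall i, mu.-negligible (N i)) -> mu.-negligible (\bigcup_i N i).
Proof.
move=> negN.
pose M k := if unpickle k is Some i then N i else set0.
have negM k : mu.-negligible (M k).
  by rewrite /M; case: unpickle => [i|]; [exact: negN|exact: negligible_set0].
apply: negligibleS (negligible_bigcup negM).
by move=> x [i _ Nx]; exists (pickle i) => //; rewrite /M pickleK.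
Qed.

(** Measurability for the completion of [mu], in the form in which [universally_measurable] states
    it for one probability. *)
Definition null_measurable (A : set T) :=
  exists B N, [/\ measurable B, mu.-negligible N & A = B `|` N].

Lemma null_measurable_bigcap (A : nat -> set T) :
  (forall i, null_measurable (A i)) -> null_measurable (\bigcap_i A i).
Proof.
move=> /choice[B] /choice[N] BN.
exists (\bigcap_i B i), ((\bigcap_i A i) `\` \bigcap_i B i); split.
- by apply: bigcapT_measurable => i; case: (BN i).
- have negN i : mu.-negligible (N i) by case: (BN i).
  apply: negligibleS (negligible_bigcup negN) => x [Ax nBx].
  apply: contrapT => nN; apply: nBx => i _.
  have [_ _ AE] := BN i; have := Ax i I; rewrite AE => -[//|Nx].
  by exfalso; apply: nN; exists i.
- apply/seteqP; split=> [x Ax|x [Bx|[]//]].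
    by have [?|?] := pselect ((\bigcap_i B i) x); [left|right].
  by move=> i _; have [_ _ ->] := BN i; left; exact: Bx.
Qed.

(* Along a Suslin scheme (E s), replace every E s by a measurable hull H s which
   is moreover disjoint from each W i that E s is disjoint from.  Outside the
   null set where some H s is not covered by its children, a point w of H [::]
   lies on a branch of hulls; the branch converges to some l, and U i l with
   W i w would force an E s far down the branch, hence H s, to avoid W i. *)
Lemma projection_null_measurable (P : topologicalType) (I : countType)
    (U : I -> set P) (W : I -> set T) :
  polish P -> (forall i, open (U i)) -> (forall i, measurable (W i)) ->
  null_measurable [set w | exists p, forall i, ~ (U i p /\ W i w)].
Proof.
move=> polP oU mW; have [cell [cell_cover _ cell_lim]] := polish_sieve P polP.
(* The most recent choice stands at the head, so the head of s chooses a cell of level [size s']. *)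
pose fix cyl (s : seq nat) : set P :=
  if s is n :: s' then cell (size s') n `&` cyl s' else setT.
pose E s := [set w | exists2 p, cyl s p & forall i, ~ (U i p /\ W i w)].
have /choice[H HP] s := measurable_hull_disjoint I W (E s) mW.
pose N s := H s `\` \bigcup_n H (n :: s).
have mHs s : measurable (\bigcup_n H (n :: s)).
  by apply: bigcup_measurable => n _; case: (HP (n :: s)).
have negN s : mu.-negligible (N s).
  have [mH _ Hmin _ _] := HP s.
  apply/negligibleP; first exact: measurableD.
  apply: Hmin => // w [p sp pw].
  (* The cells of one level cover P, so the children of [E s] cover it; minimality of [H s] then
     makes [N s] null. *)
  have [n np] := cell_cover (size s) p.
  have [_ EH _ _ _] := HP (n :: s).
  by exists n => //; apply: EH; exists p.
have [N' [mN' N'0 NN']] := negligible_bigcup_countable _ N negN.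
have branch w : H [::] w -> ~ N' w -> exists p, forall i, ~ (U i p /\ W i w).
  move=> Hw nN'w.
  have /choice[g gP] s : exists n, H s w -> H (n :: s) w.
    have [Hsw|] := pselect (H s w); last by exists 0%N.
    apply: contrapT => no; apply/nN'w/NN'; exists s => //; split=> // -[n _ Hn].
    by apply: no; exists n.
  pose t k := iter k (fun s => g s :: s) [::].
  have tH k : H (t k) w by elim: k => [//|k IH]; exact: gP.
  have size_t k : size (t k) = k by elim: k => //= k ->.
  have t_cell j k p : (j < k)%N -> cyl (t k) p -> cell j (g (t j)) p.
    elim: k => // k IH; rewrite ltnS leq_eqVlt => /orP[/eqP ->|jk] /= [cp tp].
      by rewrite size_t in cp.
    exact: IH.
  (* Since w lies in [H (t k)], the clause on empty sets makes [E (t k)], and hence the cylinder,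
     nonempty. *)
  have /choice[p pP] k : exists p, cyl (t k) p.
    apply: contrapT => no; have [_ _ _ _ H0] := HP (t k).
    have := tH k; rewrite H0//; apply/seteqP; split=> // w' [p tp _].
    by apply: no; exists p.
  have [l lP] :=
    cell_lim (fun j => g (t j)) p (fun j k jk => t_cell _ _ _ jk (pP k)).
  exists l => i [Ul Ww]; have [j jU] := lP (U i) (oU i) Ul.
  (* Length j+1 is needed because the cell of level j is imposed by the entry added at step j+1. *)
  have [_ _ _ /(_ i) HW _] := HP (t j.+1).
  have : (H (t j.+1) `&` W i) w by split=> //; exact: tH.
  rewrite HW//; apply/seteqP; split=> // w' [[q tq nq] Ww'].
  apply: (nq i); split=> //; apply: jU.
  exact: t_cell tq.
have [mH EH _ _ _] := HP [::].
exists (H [::] `\` N'), ([set w | exists p, forall i, ~ (U i p /\ W i w)] `&` N').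
split.
- exact: measurableD.
- by exists N'; split=> // w [].
- apply/seteqP; split=> [w [p pw]|w [[Hw nw]|[]//]].
    have [N'w|nN'w] := pselect (N' w); first by right; split=> //; exists p.
    by left; split=> //; apply: EH; exists p.
  exact: branch.
Qed.

End measurable_projection.

(** * Sections of analytic sets and the evaluation map *)

Lemma analytic_section_universally_measurable (Omega : ptopologicalType)
    (F R : topologicalType) (G : set (Omega * (F * R))) (f : Omega -> F) (g : Omega -> R) :
  souslin Omega -> souslin F -> souslin R -> analytic G ->
  borel_measurable f -> borel_measurable g ->
  universally_measurable [set w | G (w, (f w, g w))].
Proof.
move=> sO sF sR [->|[P [h [polP h_cont hG]]]] mf mg mu.
  exists set0, set0; split=> //; last by rewrite setU0.
  exact: negligible_set0.
have [IO [UO [VO [oUO oVO sepO]]]] := souslin_separation Omega sO.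
have [IF [UF [VF [oUF oVF sepF]]]] := souslin_separation F sF.
have [IR [UR [VR [oUR oVR sepR]]]] := souslin_separation R sR.
(* The equation h p = (w, f w, g w) is tested coordinate by coordinate: [U] constrains p through h,
   and [W] constrains w. *)
pose U (i : IO + (IF + IR)) : set P := match i with
  | inl i => (fst \o h) @^-1` UO i
  | inr (inl i) => (fst \o (snd \o h)) @^-1` UF i
  | inr (inr i) => (snd \o (snd \o h)) @^-1` UR i
  end.
pose W (i : IO + (IF + IR)) : set Omega := match i with
  | inl i => VO i
  | inr (inl i) => f @^-1` VF i
  | inr (inr i) => g @^-1` VR i
  end.
have oU i : open (U i).
  have fst_cont (X Y : topologicalType) (k : P -> X * Y) :
      continuous k -> continuous (fst \o k).
    by move=> k_cont p; apply: continuous_comp; [exact: k_cont|exact: cvg_fst].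
  have snd_cont (X Y : topologicalType) (k : P -> X * Y) :
      continuous k -> continuous (snd \o k).
    by move=> k_cont p; apply: continuous_comp; [exact: k_cont|exact: cvg_snd].
  case: i => [i|[i|i]].
  - by have /continuousP := fst_cont _ _ _ h_cont; apply.
  - by have /continuousP := fst_cont _ _ _ (snd_cont _ _ _ h_cont); apply.
  - by have /continuousP := snd_cont _ _ _ (snd_cont _ _ _ h_cont); apply.
have mW i : measurable (W i : set (OmegaB Omega)).
  case: i => [i|[i|i]].
  - by apply: sub_sigma_algebra; exact: oVO.
  - by apply: mf; apply: sub_sigma_algebra; exact: oVF.
  - by apply: mg; apply: sub_sigma_algebra; exact: oVR.
suff <- : [set w | exists p, forall i, ~ (U i p /\ W i w)] =
    [set w | G (w, (f w, g w))].
  exact: projection_null_measurable polP oU mW.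
rewrite -hG; apply/seteqP; split=> [w [p pw]|w [p _ hp]].
  exists p => //; case hE: (h p) => [w' [x y]].
  congr (_, (_, _)).
  - by apply/sepO => i; have := pw (inl i); rewrite /= hE.
  - by apply/sepF => i; have := pw (inr (inl i)); rewrite /= hE.
  - by apply/sepR => i; have := pw (inr (inr i)); rewrite /= hE.
exists p; case=> [i|[i|i]]; rewrite /= hp; move: i.
- exact/sepO.
- exact/sepF.
- exact/sepR.
Qed.

Theorem theorem5 (Omega : ptopologicalType) (F R : topologicalType)
    (leF : F -> F -> Prop) (leR : R -> R -> Prop) :
  polish Omega ->
  souslin F -> souslin R ->
  partial_order leF -> partial_order leR ->
  borel_order leF -> borel_order leR ->
  ev_quasi_measurable Omega leF leR.
Proof.
move=> polO sF sR _ _ _ _ d [rv_dp rv_F rv_R] mu.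
have coordinate_rv (X : topologicalType) (b : Omega -> seqQ Omega X) (i : nat) :
    rv_seq b -> borel_measurable (fun w => proj1_sig (b w) i).
  (* A constant random index extracts the i-th term; its preimages are empty or everything. *)
  move=> rv_b; apply: (rv_b id (fun=> i)) => // B.
  rewrite preimage_cst; case: ifP => _.
    exact: (@measurableT _ (OmegaB Omega)).
  exact: (@measurable0 _ (OmegaB Omega)).
pose G : set (Omega * (F * R)) := [set t | proj1_sig (d t.1).1.1 t.2].
pose f i w := proj1_sig (d w).1.2 i.
pose g i w := proj1_sig (d w).2 i.
(* With [mu] fixed, the quantifier over i becomes a countable intersection of sections of the
   feasible set. *)
suff -> : [set w | (@ev _ _ _ leF leR \o d) w = true] =
    \bigcap_i [set w | G (w, (f i w, g i w))].
  apply: null_measurable_bigcap => i.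
  apply: analytic_section_universally_measurable rv_dp _ _ _ => //.
  - exact: polish_souslin.
  - exact: coordinate_rv _ _ i rv_F.
  - exact: coordinate_rv _ _ i rv_R.
apply/seteqP; split=> [w /= /asboolP dw i _|w dw]; first exact: dw.
by apply/asboolP => i; exact: dw.
Qed.
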